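(* Let $d,n,t,k_1,\dots,k_d$ be positive integers with $d\ge 2$, $k_1\ge k_2\ge\cdots\ge k_d\ge t$ and $n\ge k_1+k_2+3$. Let $\mathcal{F}_1\subseteq\mathcal{M}(k_1,n),\dots,\mathcal{F}_d\subseteq\mathcal{M}(k_d,n)$ satisfy $\dim(F_1\cap\cdots\cap F_d)\ge t$ for any $F_i\in\mathcal{F}_i$, $i=1,\dots,d$. If $\prod_{i=1}^d|\mathcal{F}_i|$ attains the maximum value among all such $d$-tuples of families, then there exists a $t$-flat $T$ such that $\mathcal{F}_i=\{F\in\mathcal{M}(k_i,n):T\subseteq F\}$ for each $i\in\{1,\dots,d\}$.
   Context: $q$ is a prime power and $AG(n,\mathbb{F}_q)$ is the $n$-dimensional affine space over $\mathbb{F}_q$: a $k$-flat is a coset $P+x$ of a $k$-dimensional subspace $P$ of $\mathbb{F}_q^n$, of dimension $\dim P$. $\mathcal{M}(k,n)$ is the set of all $k$-flats. An intersection of flats is a flat or empty; the empty set is regarded as having dimension smaller than every nonnegative integer. *)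

(* Defs.v *)
From HB Require Import structures.
From mathcomp Require Import all_boot all_order all_algebra.

Set Implicit Arguments.
Unset Strict Implicit.
Unset Printing Implicit Defensive.

Import GRing.Theory.

Section AffineFlats.
Variables (F : finFieldType) (n : nat).

(* A subspace P of F^n is represented by a square matrix A whose row space *)
(* is P, so that dim P = \rank A; every subspace arises in this way.       *)
Definition flat (A : 'M[F]_n) (x : 'rV[F]_n) : {set 'rV[F]_n} :=
  [set (v + x)%R | v : 'rV[F]_n & (v <= A)%MS].

Definition flats (k : nat) : {set {set 'rV[F]_n}} :=
  [set flat p.1 p.2 | p : 'M[F]_n * 'rV[F]_n & \rank p.1 == k].

(* dim S >= t.  A k-flat is never empty, so this fails for the empty set, *)
(* even when t = 0.                                                       *)
Definition flat_dim_ge (t : nat) (S : {set 'rV[F]_n}) : Prop :=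
  exists2 m : nat, t <= m & S \in flats m.

Definition cross_intersecting (d t : nat) (k : 'I_d -> nat)
    (Fam : 'I_d -> {set {set 'rV[F]_n}}) : Prop :=
  (forall i : 'I_d, Fam i \subset flats (k i)) /\
  (forall S : 'I_d -> {set 'rV[F]_n},
     (forall i : 'I_d, S i \in Fam i) ->
     flat_dim_ge t (\bigcap_(i < d) S i)).

End AffineFlats.

Arguments flats : clear implicits.

(* Main.v *)
Require Import Defs.
From mathcomp Require Import all_boot all_order all_algebra.
From mathcomp Require Import mxabelem zify.

Set Implicit Arguments.
Unset Strict Implicit.
Unset Printing Implicit Defensive.

Import GRing.Theory.

(* Homogenization turns k-flats of F^n into (k+1)-dimensional subspaces of     *)
(* F^(n+1) not contained in the hyperplane at infinity, so everything follows  *)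
(* from a linear statement with s = t + 1, N = n + 1 and pairs of families.    *)
(* Let fA and fB be cross s-intersecting families of a- and b-subspaces of     *)
(* F^N, N >= a + b + 2, and call X an s-cover of a family when X meets each    *)
(* member in dimension >= s. If the smallest s-covers of fA and fB have        *)
(* dimensions s + u and s + v, then every A in fA contains one of the at most  *)
(* (2 q^s)^u s-subspaces of the cover of fA, and such a subspace has to be     *)
(* enlarged v times, each time in fewer than 2 q^(b-s) ways, before it can     *)
(* cover fB. This bounds |fA|, and symmetrically |fB|, and the product of the  *)
(* two bounds is smaller than that of two full stars unless u = v = 0. For     *)
(* more families, multiply the inequalities of cyclically consecutive pairs.   *)

Lemma leq_double_count (T1 T2 : finType) (A : {set T1}) (Z : {set T2})
    (r : T1 -> T2 -> bool) (c M : nat) :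
  (forall x, x \in A -> c <= #|[set z in Z | r x z]|) ->
  (forall z, z \in Z -> #|[set x in A | r x z]| <= M) ->
  #|A| * c <= #|Z| * M.
Proof.
move=> hA hZ.
have -> : #|A| * c = \sum_(x in A) c by rewrite sum_nat_const.
have -> : #|Z| * M = \sum_(z in Z) M by rewrite sum_nat_const.
apply: (@leq_trans (\sum_(x in A) \sum_(z in Z) (r x z : nat))).
  apply: leq_sum => x xA; apply: leq_trans (hA x xA) _.
  by rewrite -sum1dep_card big_mkcondr.
rewrite exchange_big /=; apply: leq_sum => z zZ; apply: leq_trans (hZ z zZ).
by rewrite -sum1dep_card big_mkcondr.
Qed.

Lemma leq_expn2r m1 m2 e : m1 <= m2 -> m1 ^ e <= m2 ^ e.
Proof. by move=> le_m; elim: e => // e IHe; rewrite !expnS leq_mul. Qed.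

(** * Subspaces of F^N and the sizes of their stars *)

Section Subspaces.
Variables (F : finFieldType) (N : nat).
Local Notation q := #|F|.
Implicit Types (U W X A B : 'M[F]_N) (z : 'rV[F]_N) (fA fB : {set 'M[F]_N}).

Let q_gt1 : 1 < q. Proof. exact: card_finNzRing_gt1. Qed.
Let q_gt0 : 0 < q. Proof. exact: ltnW. Qed.

(** The test [<<A>>%MS == A] keeps one canonical matrix per row space, so cardinalities count
    subspaces rather than matrices. *)
Definition subspaces (a : nat) : {set 'M[F]_N} :=
  [set A | (<<A>>%MS == A) && (\rank A == a)].

Definition star (a : nat) U : {set 'M[F]_N} :=
  [set A in subspaces a | (U <= A)%MS].

(** For u <= a <= N this is the Gaussian binomial of N - u over a - u, taken at a standard u-space.
    No closed formula is used, only ratios of consecutive values. *)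
Definition star_card (a u : nat) : nat := #|star a (pid_mx u)|.

Lemma genmx_subspaces m (A : 'M[F]_(m, N)) : <<A>>%MS \in subspaces (\rank A).
Proof. by rewrite inE genmx_id mxrank_gen !eqxx. Qed.

Lemma rank_subspaces a A : A \in subspaces a -> \rank A = a.
Proof. by rewrite inE => /andP[_ /eqP]. Qed.

Lemma eqmx_of_rank m1 m2 (A : 'M[F]_(m1, N)) (B : 'M[F]_(m2, N)) :
  (A <= B)%MS -> \rank B <= \rank A -> (A == B)%MS.
Proof.
by move=> sAB le_r; rewrite -(mxrank_leqif_eq sAB) eqn_leq le_r mxrankS.
Qed.

Lemma submx_of_rank_cap A X : \rank X <= \rank (A :&: X)%MS -> (X <= A)%MS.
Proof.
move=> /(eqmx_of_rank (capmxSr _ _)) /andP[_].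
by rewrite sub_capmx => /andP[].
Qed.

Lemma card_rowset m (A : 'M[F]_(m, N)) :
  #|[set z : 'rV[F]_N | (z <= A)%MS]| = q ^ \rank A.
Proof. exact: card_rowg. Qed.

Lemma rank_adds_row m (A : 'M[F]_(m, N)) z :
  ~~ (z <= A)%MS -> \rank (A + z)%MS = (\rank A).+1.
Proof.
move=> hz; apply/eqP; rewrite eqn_leq; apply/andP; split.
  rewrite (leq_trans (mxrank_adds_leqif _ _)) // -[leqRHS]addn1 leq_add2l.
  exact: rank_leq_row.
have sA := addsmxSl A z.
rewrite ltn_neqAle mxrankS // andbT (mxrank_leqif_sup sA).
by apply: contra hz; apply: submx_trans; apply: addsmxSr.
Qed.

Lemma exists_rank_between m1 m2 (U : 'M[F]_(m1, N)) (V : 'M[F]_(m2, N)) k :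
  (U <= V)%MS -> \rank U <= k -> k <= \rank V ->
  exists W, [/\ (U <= W)%MS, (W <= V)%MS & \rank W = k].
Proof.
move=> sUV /subnKC <-; elim: (k - \rank U) => [|j IHj] le_k.
  by exists <<U>>%MS; rewrite !genmxE addn0.
rewrite addnS in le_k *; have [W [sUW sWV rW]] := IHj (ltnW le_k).
have /row_subPn[i hi] : ~~ (V <= W)%MS.
  by apply: contraL le_k => /mxrankS; rewrite -leqNgt rW.
exists (W + row i V)%MS; split.
- exact: submx_trans (addsmxSl _ _).
- by rewrite addsmx_sub sWV row_sub.
- by rewrite rank_adds_row // rW.
Qed.

(** An invertible P acts injectively on subspaces and preserves rank and inclusion. One inequality
    is enough: [card_star] uses it in both directions. *)
Lemma star_card_unit a U (P : 'M[F]_N) : P \in unitmx ->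
  #|star a U| <= #|star a (U *m P)%R|.
Proof.
move=> uP; have fP : row_free P by rewrite row_free_unit.
pose f A := <<(A *m P)%R>>%MS.
have inj_f : {in star a U &, injective f}.
  move=> A B; rewrite !inE => /andP[/andP[/eqP gA _] _] /andP[/andP[/eqP gB _] _].
  rewrite /f => /genmxP; rewrite !submxMfree // => /genmxP.
  by rewrite gA gB.
rewrite -(card_in_imset inj_f); apply: subset_leq_card.
apply/subsetP => _ /imsetP[A + ->]; rewrite !inE => /andP[/andP[_ rA] sUA].
by rewrite genmx_id eqxx !genmxE mxrankMfree // submxMfree // rA.
Qed.

Lemma eq_star a m (U : 'M[F]_N) (V : 'M[F]_(m, N)) :
  (U :=: V)%MS -> star a U = [set A in subspaces a | (V <= A)%MS].
Proof. by move=> eqUV; apply/setP => A; rewrite !inE eqUV. Qed.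

Lemma card_star a U : #|star a U| = star_card a (\rank U).
Proof.
have uL := row_ebase_unit U; set L := row_ebase U in uL.
have eqU : (U :=: ((pid_mx (\rank U) : 'M_N) *m L)%R)%MS.
  rewrite -{1}(mulmx_ebase U) -mulmxA; apply: eqmxMfull.
  by rewrite row_full_unit col_ebase_unit.
have eqUV : ((U *m invmx L)%R :=: (pid_mx (\rank U) : 'M_N))%MS.
  by apply: eqmx_trans (eqmxMr _ eqU) _; rewrite mulmxK.
apply/eqP; rewrite eqn_leq /star_card; apply/andP; split.
  have := star_card_unit a U (etrans (unitmx_inv _) uL).
  by rewrite (eq_star _ eqUV).
have := star_card_unit a (pid_mx (\rank U)) uL.
by rewrite (eq_star _ (eqmx_sym eqU)).
Qed.

Lemma star_card_gt0 a u : u <= a -> a <= N -> 0 < star_card a u.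
Proof.
move=> le_ua le_aN.
have rU : \rank (pid_mx u : 'M[F]_N) = u by rewrite rank_pid_mx; lia.
have [|||W [sW _ rW]] := @exists_rank_between _ _ (pid_mx u : 'M[F]_N) 1%:M%R a.
- exact: submx1.
- by rewrite rU.
- by rewrite mxrank1.
rewrite card_gt0; apply/set0Pn; exists <<W>>%MS.
by rewrite inE -rW genmx_subspaces genmxE.
Qed.

(* Double counting of the pairs (A, z) with U <= A and z in A \ U gives *)
(* (q^N - q^u) g(u+1) = g(u) (q^a - q^u).                                *)
Lemma star_card_step a u : u < a -> a <= N ->
  q ^ (N - a) * star_card a u.+1 <= star_card a u.
Proof.
move=> lt_ua le_aN; pose U : 'M[F]_N := pid_mx u.
have rU : \rank U = u by rewrite rank_pid_mx; lia.
pose Z := [set z : 'rV[F]_N | ~~ (z <= U)%MS].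
have cardZ : #|Z| + q ^ u = q ^ N.
  have := cardsC [set z : 'rV[F]_N | (z <= U)%MS]; rewrite card_rowset rU card_mx mul1n addnC.
  by move=> <-; congr (_ + _); apply: eq_card => z; rewrite !inE.
have key : #|Z| * star_card a u.+1 <= star_card a u * (q ^ a - q ^ u).
  rewrite mulnC.
  have -> : star_card a u * (q ^ a - q ^ u) = #|star a U| * (q ^ a - q ^ u).
    by rewrite card_star rU.
  have cnt A : A \in star a U -> #|[set z in Z | (z <= A)%MS]| = q ^ a - q ^ u.
    rewrite inE => /andP[hA sUA].
    have := cardsID [set z : 'rV[F]_N | (z <= U)%MS] [set z : 'rV[F]_N | (z <= A)%MS].
    rewrite card_rowset (rank_subspaces hA).
    have -> : [set z : 'rV[F]_N | (z <= A)%MS] :&: [set z | (z <= U)%MS]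
             = [set z | (z <= U)%MS].
      apply/setP => z; rewrite !inE andb_idl // => /submx_trans; exact.
    rewrite card_rowset rU => <-; rewrite addKn; apply: eq_card => z.
    by rewrite !inE.
  have cnt2 z : z \in Z -> #|[set A in star a U | (z <= A)%MS]| = star_card a u.+1.
    rewrite inE => hz; rewrite -rU -(rank_adds_row hz) -card_star.
    by apply: eq_card => A; rewrite !inE addsmx_sub -andbA.
  rewrite mulnC -sum_nat_const -sum_nat_const.
  rewrite -(eq_bigr _ cnt2) -(eq_bigr _ cnt).
  under eq_bigr do rewrite -sum1dep_card big_mkcondr /=.
  rewrite exchange_big /=.
  by under eq_bigr do rewrite -big_mkcondr sum1dep_card.
have lt_q : q ^ u < q ^ a by rewrite ltn_exp2l.
have e : q ^ N = q ^ (N - a) * q ^ a by rewrite -expnD subnK.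
have g1 : 0 < q ^ (N - a) by rewrite expn_gt0 q_gt0.
rewrite -(@leq_pmul2r (q ^ a - q ^ u)) ?subn_gt0 //.
apply: leq_trans key; rewrite mulnAC leq_mul2r; apply/orP; right.
rewrite mulnBr -e -cardZ leq_subLR [leqRHS]addnC leq_add2l.
exact: leq_pmull.
Qed.

Lemma star_card_steps a u v : u + v <= a -> a <= N ->
  q ^ ((N - a) * v) * star_card a (u + v) <= star_card a u.
Proof.
move=> + le_aN; elim: v => [|v IHv] le_a; first by rewrite muln0 mul1n addn0.
rewrite addnS in le_a *; apply: leq_trans (IHv (ltnW le_a)).
by rewrite mulnS addnC expnD -mulnA leq_mul2l star_card_step ?orbT.
Qed.

(** * Bounds by branching: enlarging a subspace that fails to cover *)

Lemma card_nonzero_rowset m (A : 'M[F]_(m, N)) :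
  #|[set z : 'rV[F]_N | (z <= A)%MS && (z != 0%R)]| = q ^ \rank A - 1.
Proof.
have := cardsD1 (0%R : 'rV[F]_N) [set z : 'rV[F]_N | (z <= A)%MS].
rewrite card_rowset inE sub0mx => ->; rewrite addKn.
by apply: eq_card => z; rewrite !inE andbC.
Qed.

(* B contains a space D of dimension b - s + 1 that meets U trivially; every *)
(* A containing U meets D in a nonzero vector z, hence contains U + z.       *)
Lemma branch_step fA U B s M : \rank (U :&: B)%MS < s -> s <= \rank B ->
  (forall A, A \in fA -> s <= \rank (A :&: B)%MS) ->
  (forall W, \rank W = (\rank U).+1 -> #|[set A in fA | (W <= A)%MS]| <= M) ->
  #|[set A in fA | (U <= A)%MS]| * (q - 1) <= (q ^ (\rank B - s).+1 - 1) * M.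
Proof.
move=> ltUB le_sB hAB hW; set m := (\rank B - s).+1.
have rBU := mxrank_cap_compl B U; rewrite capmxC in rBU.
have [|||D [_ sDBU rD]] := @exists_rank_between _ _ (0%R : 'M_N) (B :\: U)%MS m.
- exact: sub0mx.
- by rewrite mxrank0.
- lia.
have sDB : (D <= B)%MS := submx_trans sDBU (diffmxSl _ _).
rewrite -rD -card_nonzero_rowset.
apply: (leq_double_count (r := fun A z => (z <= A)%MS)) => [A|z].
  rewrite inE => /andP[hA sUA].
  have r1 : 0 < \rank (A :&: D)%MS.
    have := mxrank_sum_cap (A :&: B)%MS D.
    have : \rank (A :&: B + D)%MS <= \rank B.
      by apply: mxrankS; rewrite addsmx_sub capmxSr.
    have : \rank ((A :&: B) :&: D)%MS <= \rank (A :&: D)%MS.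
      by apply: mxrankS; apply: capmxS => //; apply: capmxSl.
    have := hAB A hA; rewrite rD; lia.
  apply: (@leq_trans (q ^ \rank (A :&: D)%MS - 1)).
    by rewrite leq_sub2r // -[leqLHS]expn1 leq_exp2l.
  rewrite -card_nonzero_rowset; apply: subset_leq_card; apply/subsetP => z.
  by rewrite !inE sub_capmx => /andP[/andP[-> ->] ->].
rewrite inE => /andP[zD z0].
have zU : ~~ (z <= U)%MS.
  apply: contra z0 => zU; rewrite -submx0 -(capmx_diff B U) sub_capmx zU andbT.
  exact: submx_trans zD sDBU.
apply: leq_trans (hW _ (rank_adds_row zU)); apply: eq_leq.
by apply: eq_card => A; rewrite !inE addsmx_sub -andbA.
Qed.

(** With m = [\rank B - s], the space D has (q^(m+1) - 1)/(q - 1) < 2 q^m points, because q <= 2 (q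
    - 1). The strictness, which rests on M > 0, is what finally excludes u + v > 0. *)
Lemma branch_step_lt fA U B s M : \rank (U :&: B)%MS < s -> s <= \rank B ->
  (forall A, A \in fA -> s <= \rank (A :&: B)%MS) ->
  0 < M ->
  (forall W, \rank W = (\rank U).+1 -> #|[set A in fA | (W <= A)%MS]| <= M) ->
  #|[set A in fA | (U <= A)%MS]| < 2 * q ^ (\rank B - s) * M.
Proof.
move=> ltUB le_sB hAB M0 hW; have := branch_step ltUB le_sB hAB hW.
set c := #|_|; set m := \rank B - s => hc.
have hq : 0 < q ^ m by rewrite expn_gt0 q_gt0.
have lt1 : (q ^ m.+1 - 1) * M < q ^ m.+1 * M by rewrite ltn_pmul2r // expnS; nia.
have lt2 : q ^ m.+1 * M <= 2 * q ^ m * M * (q - 1).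
  rewrite mulnAC leq_pmul2r // expnS; nia.
rewrite -(@ltn_pmul2r (q - 1)) ?subn_gt0 //.
exact: leq_ltn_trans hc (leq_trans lt1 lt2).
Qed.

(** Induction on j, the number of dimensions U lacks to reach s + v. While j > 0, U is too small to
    cover fB, so some B allows a branching step; at j = 0 the star of U is the bound. The summand
    [(0 < j)] records strictness. *)
Lemma branch_bound fA fB a b s v j U :
  fA \subset subspaces a -> fB \subset subspaces b -> s <= b -> s + v <= a ->
  a <= N ->
  (forall A B, A \in fA -> B \in fB -> s <= \rank (A :&: B)%MS) ->
  (forall T : 'M[F]_N, \rank T < s + v -> exists2 B, B \in fB & \rank (T :&: B)%MS < s) ->
  \rank U + j = s + v ->
  #|[set A in fA | (U <= A)%MS]| + (0 < j)
    <= (2 * q ^ (b - s)) ^ j * star_card a (s + v).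
Proof.
move=> /subsetP hA /subsetP hB le_sb le_va le_aN hAB nocov.
elim: j U => [|j IHj] U rU.
  rewrite mul1n addn0 -rU addn0 -card_star; apply: subset_leq_card.
  by apply/subsetP => A; rewrite !inE => /andP[/hA]; rewrite inE => -> ->.
have [|B fB_B ltB] := nocov U; first lia.
have rB := rank_subspaces (hB B fB_B).
rewrite addn1 expnS -mulnA -{1}rB; apply: (@branch_step_lt _ _ B) => //.
- by rewrite rB.
- by move=> A /hAB; apply.
- by rewrite muln_gt0 expn_gt0 muln_gt0 expn_gt0 q_gt0 star_card_gt0.
- move=> W rW; apply: leq_trans (IHj W _); first exact: leq_addr.
  by rewrite rW -rU addSnnS.
Qed.

(** * Bounds by averaging over the s-subspaces of a cover *)

Lemma card_colset m (A : 'M[F]_(m, N)) :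
  #|[set c : 'cV[F]_N | (A *m c)%R == 0%R]| = q ^ (N - \rank A).
Proof.
rewrite -(mxrank_tr A) -mxrank_ker -card_rowset -(card_imset _ trmx_inj).
apply: eq_card => z; rewrite [RHS]inE sub_kermx.
apply/imsetP/idP => [[c]|/eqP hz].
  by rewrite inE => /eqP hc ->; rewrite -trmx_mul hc trmx0.
exists (z^T)%R; last by rewrite trmxK.
by rewrite inE -[A]trmxK -trmx_mul hz trmx0.
Qed.

(* Averaging over the hyperplanes X :&: ker c of X: those containing a fixed *)
(* s-space in A :&: X come from q^(N-s) - q^(N-x) of the q^N - q^(N-x)       *)
(* functionals c that do not vanish on X.                                    *)
Lemma cover_bound fA s u M X : \rank X = s + u ->
  (forall S : 'M[F]_N, \rank S = s -> #|[set A in fA | (S <= A)%MS]| <= M) ->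
  #|[set A in fA | s <= \rank (A :&: X)%MS]| <= (2 * q ^ s) ^ u * M.
Proof.
move=> rX hM; elim: u X rX => [|u IHu] X rX.
  rewrite mul1n; apply: leq_trans (hM X _); last by rewrite rX addn0.
  apply: subset_leq_card; apply/subsetP => A; rewrite !inE => /andP[-> le_s] /=.
  by apply: submx_of_rank_cap; rewrite rX addn0.
set M' := (2 * q ^ s) ^ u * M.
pose Z := [set c : 'cV[F]_N | (X *m c)%R != 0%R].
have le_xN : s + u.+1 <= N by rewrite -rX rank_leq_row.
have cardZ : #|Z| + q ^ (N - (s + u.+1)) = q ^ N.
  have := cardsC [set c : 'cV[F]_N | (X *m c)%R == 0%R].
  rewrite card_colset rX card_mx muln1 addnC => <-; congr (_ + _).
  by apply: eq_card => c; rewrite !inE.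
have key : #|[set A in fA | s <= \rank (A :&: X)%MS]|
           * (q ^ (N - s) - q ^ (N - (s + u.+1))) <= #|Z| * M'.
  apply: (leq_double_count
    (r := fun A (c : 'cV[F]_N) => s <= \rank (A :&: (X :&: kermx c))%MS)) => [A|c].
    rewrite inE => /andP[_ le_s].
    have [|||S [_ sS rS]] := @exists_rank_between _ _ (0%R : 'M_N) (A :&: X)%MS s.
    - exact: sub0mx.
    - by rewrite mxrank0.
    - by [].
    move: sS; rewrite sub_capmx => /andP[sSA sSX].
    rewrite -{1}rS -rX -!card_colset leq_subLR -cardsUI.
    apply: leq_trans (leq_addr _ _); apply: subset_leq_card.
    apply/subsetP => c; rewrite !inE => Sc; case: eqP => //= Xc.
    rewrite -rS; apply: mxrankS; rewrite !sub_capmx sSA sSX sub_kermx.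
    exact: Sc.
  rewrite inE => Xc.
  apply: leq_trans (IHu (X :&: kermx c)%MS _).
    apply: subset_leq_card; apply/subsetP => A; rewrite !inE.
    by case/andP => /andP[-> _] ->.
  have := mxrank_mul_ker X c; rewrite rX.
  have : 0 < \rank (X *m c)%R by rewrite lt0n mxrank_eq0.
  have := rank_leq_col (X *m c)%R.
  move: (\rank (X *m c)%R) (\rank (X :&: kermx c)%MS) => r1 r2; lia.
have hgt : 0 < q ^ (N - s) - q ^ (N - (s + u.+1)).
  by rewrite subn_gt0 ltn_exp2l //; lia.
rewrite -(@leq_pmul2r _ _ _ hgt); apply: leq_trans key _.
rewrite expnS -[X in _ <= X * _]mulnA -/M' [leqRHS]mulnAC leq_mul2r; apply/orP; right.
have e1 : q ^ N = q ^ s * q ^ (N - s) by rewrite -expnD; congr (_ ^ _); lia.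
have e2 : q ^ (N - s) = q ^ u.+1 * q ^ (N - (s + u.+1)).
  by rewrite -expnD; congr (_ ^ _); lia.
(* With y, w, p as named below, the goal reduces to p y - w <= 2 p (y - w), which follows from 2 w
   <= y. *)
have : 2 * q ^ (N - (s + u.+1)) <= q ^ (N - s).
  rewrite e2 leq_mul2r; apply/orP; right.
  by apply: leq_trans q_gt1 _; rewrite -[leqLHS]expn1 leq_exp2l.
move: cardZ e1; set y := q ^ (N - s); set w := q ^ (N - _).
set p := q ^ s; nia.
Qed.

(** * Minimal covers and pairs of families *)

Definition covers s X fA := [forall A in fA, s <= \rank (A :&: X)%MS].

Lemma coversPn s X fA :
  reflect (exists2 A, A \in fA & \rank (X :&: A)%MS < s) (~~ covers s X fA).
Proof.
rewrite negb_forall_in; apply: (iffP exists_inP) => -[A hA hr]; exists A => //.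
  by rewrite capmxC ltnNge.
by rewrite -ltnNge capmxC.
Qed.

(** A cover of a nonempty family has dimension at least s, whence the form s + u. The bound by
    [\rank X] is used with X a member of the other family. *)
Lemma min_cover s fA X : fA != set0 -> covers s X fA ->
  exists u Y, [/\ \rank Y = s + u, s + u <= \rank X, covers s Y fA
    & forall T, \rank T < s + u -> ~~ covers s T fA].
Proof.
move=> /set0Pn[A0 hA0] covX.
pose P m := [exists Y : 'M[F]_N, (\rank Y == m) && covers s Y fA].
have exP : exists m, P m.
  by exists (\rank X); apply/existsP; exists X; rewrite eqxx.
case: (ex_minnP exP) => m /existsP[Y /andP[/eqP rY covY]] minm.
have le_sm : s <= m.
  move/forall_inP: (covY) => /(_ _ hA0) /leq_trans; apply.
  by rewrite -rY mxrankS // capmxSr.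
exists (m - s), Y; rewrite subnKC //; split=> // [|T ltT].
  by apply: minm; apply/existsP; exists X; rewrite eqxx.
apply: contraL ltT => covT; rewrite -leqNgt; apply: minm.
by apply/existsP; exists T; rewrite eqxx.
Qed.

(** [cover_bound] passes from fA to the members through one s-space, [branch_bound] from there to
    dimension s + v, and [star_card_steps] trades [star_card a (s + v)] for [star_card a s], gaining
    q^((N-a)v). The summand [(0 < v)] keeps the inequality strict when branching occurs. *)
Lemma half_bound fA fB a b s u v X :
  fA \subset subspaces a -> fB \subset subspaces b -> s <= b -> s + v <= a ->
  a <= N ->
  (forall A B, A \in fA -> B \in fB -> s <= \rank (A :&: B)%MS) ->
  \rank X = s + u -> covers s X fA ->
  (forall T : 'M[F]_N, \rank T < s + v -> ~~ covers s T fB) ->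
  (#|fA| + (0 < v)) * q ^ ((N - a) * v)
    <= (2 * q ^ s) ^ u * (2 * q ^ (b - s)) ^ v * star_card a s.
Proof.
move=> hA hB le_sb le_va le_aN hAB rX covX nocov.
set Bd := (2 * q ^ (b - s)) ^ v * star_card a (s + v).
have hS (S : 'M[F]_N) : \rank S = s ->
    #|[set A in fA | (S <= A)%MS]| <= Bd - (0 < v).
  move=> rS; rewrite leq_subRL; last first.
    apply: leq_trans (leq_b1 _) _.
    by rewrite muln_gt0 expn_gt0 muln_gt0 expn_gt0 q_gt0 star_card_gt0.
  rewrite addnC; apply: branch_bound hA hB le_sb le_va le_aN hAB _ _; last first.
    by rewrite rS.
  by move=> T /nocov /coversPn.
have := cover_bound rX hS.
have -> : [set A in fA | s <= \rank (A :&: X)%MS] = fA.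
  by apply/setP => A; rewrite inE andb_idr // => /(forall_inP covX).
set p := (2 * q ^ s) ^ u => hfA.
have p0 : 0 < p by rewrite expn_gt0 muln_gt0 expn_gt0 q_gt0.
have Bd0 : (0 < v) <= Bd.
  apply: leq_trans (leq_b1 _) _.
  by rewrite muln_gt0 expn_gt0 muln_gt0 expn_gt0 q_gt0 star_card_gt0.
have {hfA} : #|fA| + (0 < v) <= p * Bd by nia.
move/leq_mul => /(_ _ _ (leqnn (q ^ ((N - a) * v)))) /leq_trans; apply.
rewrite /Bd -!mulnA leq_mul2l; apply/orP; right.
rewrite leq_mul2l; apply/orP; right.
by rewrite mulnC star_card_steps.
Qed.

(* u and v are the excesses over s of the smallest s-covers of fA and fB.    *)
(* Since (2 q^s)(2 q^(b-s)) = 4 q^b <= q^(N-a), the two half bounds multiply *)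
(* to the claim as soon as u + v > 0.                                        *)
Lemma cross_pair fA fB a b s :
  a + b + 2 <= N -> s <= a -> s <= b ->
  fA \subset subspaces a -> fB \subset subspaces b ->
  fA != set0 -> fB != set0 ->
  (forall A B, A \in fA -> B \in fB -> s <= \rank (A :&: B)%MS) ->
  star_card a s * star_card b s <= #|fA| * #|fB| ->
  exists T, [/\ \rank T = s, fA \subset star a T & fB \subset star b T].
Proof.
move=> leN le_sa le_sb hA hB A0 B0 hAB big.
have le_aN : a <= N by lia.
have le_bN : b <= N by lia.
have hBA B A : B \in fB -> A \in fA -> s <= \rank (B :&: A)%MS.
  by move=> fB_B fA_A; rewrite capmxC hAB.
have [B1 fB1] := set0Pn _ B0; have [A1 fA1] := set0Pn _ A0.
have rA1 := rank_subspaces (subsetP hA _ fA1).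
have rB1 := rank_subspaces (subsetP hB _ fB1).
have [|u [X [rX le_ub covX noX]]] := @min_cover s fA B1 A0.
  by apply/forall_inP => A fA_A; apply: hAB.
have [|v [Y [rY le_va covY noY]]] := @min_cover s fB A1 B0.
  by apply/forall_inP => B fB_B; apply: hBA.
rewrite rB1 in le_ub; rewrite rA1 in le_va.
have cA0 : 0 < #|fA| by rewrite card_gt0.
have cB0 : 0 < #|fB| by rewrite card_gt0.
have q4 m n' : s <= m -> m + 2 <= n' -> 2 * q ^ s * (2 * q ^ (m - s)) <= q ^ n'.
  move=> le_sm le_mn; apply: (@leq_trans (q ^ (m + 2))); last by rewrite leq_exp2l.
  rewrite expnD mulnACA -expnD subnKC // mulnC leq_mul2l; apply/orP; right.
  by rewrite expnS expn1 leq_mul.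
have qa : 2 * q ^ s * (2 * q ^ (b - s)) <= q ^ (N - a) by apply: q4 => //; lia.
have qb : 2 * q ^ s * (2 * q ^ (a - s)) <= q ^ (N - b) by apply: q4 => //; lia.
have [uv0|uv0] := boolP ((0 < u) || (0 < v)).
  have hfA := half_bound hA hB le_sb le_va le_aN hAB rX covX noY.
  have hfB := half_bound hB hA le_sa le_ub le_bN hBA rY covY noX.
  have := leq_mul hfA hfB; rewrite mulnACA [leqRHS]mulnACA.
  (* Grouped by exponent, the bases are (2 q^s)(2 q^(b-s)) for v and (2 q^s)(2 q^(a-s)) for u,
     bounded by [qa] and [qb]. *)
  have le_pq : (2 * q ^ s) ^ u * (2 * q ^ (b - s)) ^ v
      * ((2 * q ^ s) ^ v * (2 * q ^ (a - s)) ^ u)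
      <= q ^ ((N - a) * v) * q ^ ((N - b) * u).
    rewrite [X in X * _]mulnC mulnACA -!expnMn [X in X ^ v]mulnC !(expnM q).
    by apply: leq_mul; apply: leq_expn2r.
  move/leq_trans => /(_ _ (leq_mul le_pq (leqnn _))).
  rewrite mulnC leq_pmul2l ?muln_gt0 ?expn_gt0 ?q_gt0 //.
  move=> /leq_trans /(_ big); clear -uv0 cA0 cB0.
  (* What remains is (|fA| + (0 < v)) (|fB| + (0 < u)) <= |fA| |fB|, impossible for nonempty
     families when u or v is positive. *)
  rewrite leqNgt mulnDl !mulnDr -addnA -[X in X < _]addn0 ltn_add2l.
  by rewrite !addn_gt0 !muln_gt0 cA0 cB0 !lt0b andbT orbA uv0.
have [u0 v0] : u = 0 /\ v = 0 by lia.
rewrite u0 addn0 in rX; rewrite v0 addn0 in rY.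
have sX A : A \in fA -> (X <= A)%MS.
  by move=> /(forall_inP covX) hr; apply: submx_of_rank_cap; rewrite rX.
have sY B : B \in fB -> (Y <= B)%MS.
  by move=> /(forall_inP covY) hr; apply: submx_of_rank_cap; rewrite rY.
have inA T : (forall A, A \in fA -> (T <= A)%MS) -> fA \subset star a T.
  by move=> hT; apply/subsetP => A hfA; rewrite inE (subsetP hA) // hT.
have inB T : (forall B, B \in fB -> (T <= B)%MS) -> fB \subset star b T.
  by move=> hT; apply/subsetP => B hfB; rewrite inE (subsetP hB) // hT.
(* Now X lies in every member of fA and Y in every member of fB. If X does not cover fB, branching
   at an uncovered B makes fA strictly smaller than a full star, while fB is at most one: this
   contradicts [big]. *)
have [covXB|/coversPn[B fB_B ltB]] := boolP (covers s X fB).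
  exists X; split=> //; [exact: inA | apply: inB => B /(forall_inP covXB) hr].
  by apply: submx_of_rank_cap; rewrite rX.
have rB := rank_subspaces (subsetP hB _ fB_B).
have lt_sa : s < a.
  rewrite ltn_neqAle le_sa andbT; apply: contraL ltB => /eqP eq_sa.
  rewrite -leqNgt; apply: leq_trans (hAB _ _ fA1 fB_B) _.
  apply: mxrankS; apply: capmxS => //.
  have /andP[_ ->] // : (X == A1)%MS.
  by apply: eqmx_of_rank (sX _ fA1) _; rewrite rA1 rX eq_sa.
have leB : #|fB| <= star_card b s.
  by rewrite -rY -card_star; apply: subset_leq_card; apply: inB.
have ltA : #|fA| < star_card a s.
  have -> : fA = [set A in fA | (X <= A)%MS].
    by apply/setP => A; rewrite inE andb_idr // => /sX.
  apply: leq_trans (star_card_step lt_sa le_aN).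
  have g0 := star_card_gt0 lt_sa le_aN.
  apply: leq_trans (@branch_step_lt _ _ B s (star_card a s.+1) ltB _ _ g0 _) _.
  - by rewrite rB.
  - by move=> A fA_A; apply: hAB.
  - move=> W rW; rewrite -rX -rW -card_star; apply: subset_leq_card.
    by apply/subsetP => A; rewrite !inE => /andP[/(subsetP hA)]; rewrite inE => -> ->.
  - rewrite rB leq_pmul2r //; apply: leq_trans qa; rewrite leq_pmull //.
    by rewrite muln_gt0 expn_gt0 q_gt0.
by move: big; rewrite leqNgt (leq_trans _ (leq_mul ltA leB)) // ltn_pmul2r.
Qed.

(** A row z of T2 outside T1 would lie in every a-space through T1, so the stars of T1 and T1 + z
    would have the same size; but by [star_card_step] they differ by a factor of at least q^(N-a) >
    1. If T1 has rank a, it is itself a member of its star. *)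
Lemma star_inj a T1 T2 : \rank T1 = \rank T2 -> \rank T1 <= a -> a < N ->
  star a T1 \subset star a T2 -> (T1 :=: T2)%MS.
Proof.
move=> eq_r le_ra lt_aN sT.
suff sT21 : (T2 <= T1)%MS.
  by apply/eqmx_sym/eqmxP/eqmx_of_rank; rewrite ?eq_r.
case: (ltngtP (\rank T1) a) le_ra => // [lt_ra _|eq_ra _]; last first.
  have : <<T1>>%MS \in star a T1 by rewrite inE -eq_ra genmx_subspaces genmxE submx_refl.
  by move/(subsetP sT); rewrite inE genmxE => /andP[].
apply: contraT => /row_subPn[i hi].
have := star_card_step lt_ra (ltnW lt_aN).
have : star_card a (\rank T1) <= star_card a (\rank T1).+1.
  rewrite -(rank_adds_row hi) -!card_star; apply: subset_leq_card.
  apply/subsetP => A hA; have := subsetP sT A hA; move: hA.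
  rewrite !inE addsmx_sub => /andP[-> ->] /andP[_ sA].
  by rewrite (submx_trans (row_sub _ _) sA).
have := star_card_gt0 lt_ra (ltnW lt_aN).
have : 1 < q ^ (N - a) by rewrite -[ltnLHS](expn0 q) ltn_exp2l // subn_gt0.
nia.
Qed.

End Subspaces.

(** * Homogenization: flats of F^n as subspaces of F^(1+n) *)

Section Homogenization.
Variables (F : finFieldType) (n : nat).
Implicit Types (M : 'M[F]_(1 + n)) (v x : 'rV[F]_n).

(** A point v of F^n becomes (1, v); the vectors (0, u) of this hyperplane are the directions. *)
Definition infinity : 'M[F]_(n, 1 + n) := row_mx 0%R 1%:M%R.

Definition affine_part M : {set 'rV[F]_n} :=
  [set v | (row_mx 1%:M%R v <= M)%MS].

Lemma mul_infinity m (A : 'M[F]_(m, n)) :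
  (A *m infinity)%R = row_mx (0%R : 'M_(m, 1)) A.
Proof. by rewrite mul_mx_row mulmx0 mulmx1. Qed.

Lemma infinity_free : row_free infinity.
Proof.
apply/row_freeP; exists (col_mx 0%R 1%:M%R).
by rewrite mul_row_col mul0mx add0r mulmx1.
Qed.

Lemma sub_infinity (w : 'rV[F]_(1 + n)) :
  (w <= infinity)%MS = (lsubmx w == 0%R).
Proof.
apply/submxP/eqP => [[u ->]|w0]; first by rewrite mul_infinity row_mxKl.
by exists (rsubmx w); rewrite mul_infinity -w0 hsubmxK.
Qed.

Lemma point_infinityN v : ~~ (row_mx 1%:M%R v <= infinity)%MS.
Proof. by rewrite sub_infinity row_mxKl -mxrank_eq0 mxrank1. Qed.

Lemma scaled_point (w : 'rV[F]_(1 + n)) : ~~ (w <= infinity)%MS ->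
  exists2 v, (row_mx 1%:M%R v <= w)%MS & (w <= (row_mx 1%:M%R v : 'rV_(1 + n)))%MS.
Proof.
rewrite sub_infinity => w0; set c : F := lsubmx w 0%R 0%R.
have eqc : lsubmx w = (c%:M)%R by rewrite [LHS]mx11_scalar.
have c0 : c != 0%R by apply: contra w0 => /eqP c0; rewrite eqc c0 raddf0.
have e : w = (c *: row_mx 1%:M (c^-1 *: rsubmx w))%R.
  by rewrite scale_row_mx scalerA divff // scale1r scale_scalar_mx mulr1 -eqc hsubmxK.
exists (c^-1 *: rsubmx w)%R; last by rewrite {1}e scalemx_sub.
by rewrite {2}e eqmx_scale.
Qed.

Lemma affine_part_point M : ~~ (M <= infinity)%MS ->
  exists v, v \in affine_part M.
Proof.
move=> /row_subPn[i /scaled_point[v sv _]]; exists v.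
by rewrite inE (submx_trans sv) // row_sub.
Qed.

(** A subspace off infinity is spanned by its points: a vector w at infinity is the difference of
    two points, (1, v0) + w and (1, v0). *)
Lemma affine_part_sub M M' : ~~ (M <= infinity)%MS ->
  (affine_part M \subset affine_part M') = (M <= M')%MS.
Proof.
move=> hM; apply/idP/idP => [sM|sM]; last first.
  by apply/subsetP => v; rewrite !inE => /submx_trans; apply.
have [v0 hv0] := affine_part_point hM.
apply/row_subP => i; set w := row i M; have wM : (w <= M)%MS by apply: row_sub.
have [wi|/scaled_point[v sv sw]] := boolP (w <= infinity)%MS; last first.
  have /(subsetP sM) : v \in affine_part M by rewrite inE (submx_trans sv).
  by rewrite inE; apply: submx_trans.
have e : (w + row_mx 1%:M v0 = row_mx 1%:M (rsubmx w + v0))%R.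
  rewrite -{1}[w]hsubmxK; move: wi; rewrite sub_infinity => /eqP ->.
  by rewrite add_row_mx add0r.
have /(subsetP sM) : (rsubmx w + v0)%R \in affine_part M.
  by rewrite inE -e addmx_sub //; move: hv0; rewrite inE.
have /(subsetP sM) := hv0; rewrite !inE -e => h0 h1.
by rewrite -[w](addrK (row_mx 1%:M v0)%R) addmx_sub // eqmx_opp.
Qed.

Lemma mem_flat (A : 'M[F]_n) x v : (v \in flat A x) = ((v - x)%R <= A)%MS.
Proof.
apply/imsetP/idP => [[u]|hv]; first by rewrite inE => hu ->; rewrite addrK.
by exists (v - x)%R; rewrite ?inE ?subrK.
Qed.

Lemma rank_cap_infinity M : ~~ (M <= infinity)%MS ->
  (\rank (infinity :&: M)%MS).+1 = \rank M.
Proof.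
move=> hM; have := mxrank_sum_cap infinity M.
have rI : \rank infinity = n by apply/eqP/infinity_free.
have : \rank (infinity + M)%MS <= 1 + n by apply: rank_leq_row.
have : \rank infinity < \rank (infinity + M)%MS.
  have sI := addsmxSl infinity M.
  rewrite ltn_neqAle mxrankS // andbT (mxrank_leqif_sup sI).
  by apply: contra hM; apply: submx_trans; apply: addsmxSr.
rewrite rI; move: (\rank _) (\rank _) (\rank _) => r1 r2 r3; lia.
Qed.

Lemma affine_part_flats M k : ~~ (M <= infinity)%MS -> \rank M = k.+1 ->
  affine_part M \in flats F n k.
Proof.
move=> hM rM; have [x hx] := affine_part_point hM.
(* The direction space: all u with (0, u) in M. *)
pose A := kermx (infinity *m cokermx M)%R.
apply/imsetP; exists (A, x).
  rewrite inE /= mxrank_ker; have := mxrank_mul_ker infinity (cokermx M).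
  have -> : \rank (infinity :&: kermx (cokermx M))%MS = \rank (infinity :&: M)%MS.
    apply/eqmx_rank/eqmxP/cap_eqmx => //; apply/eqmxP/andP; split.
      by rewrite submxE mulmx_ker.
    by rewrite sub_kermx -submxE.
  have := rank_cap_infinity hM; rewrite rM => -[->].
  have -> : \rank infinity = n by apply/eqP/infinity_free.
  by move=> e; rewrite -[X in X - _]e addKn.
apply/setP => v; rewrite mem_flat sub_kermx mulmxA -submxE mul_infinity inE.
have e : (row_mx 1%:M v = row_mx (0 : 'M_1) (v - x) + row_mx 1%:M x)%R.
  by rewrite add_row_mx add0r subrK.
move: hx; rewrite inE => hx; apply/idP/idP => h; last by rewrite e addmx_sub.
by rewrite -[row_mx _ _](addrK (row_mx 1%:M x)%R) -e addmx_sub // eqmx_opp.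
Qed.

Lemma flats_affine_part S k : S \in flats F n k ->
  exists M, [/\ M \in subspaces F (1 + n) k.+1, ~~ (M <= infinity)%MS
              & affine_part M = S].
Proof.
case/imsetP => -[A x]; rewrite inE /= => /eqP rA ->.
pose M := ((A *m infinity)%R + row_mx 1%:M%R x)%MS.
have hx : ~~ (row_mx 1%:M%R x <= (A *m infinity)%R)%MS.
  by apply: contra (point_infinityN x) => /submx_trans -> //; apply: submxMl.
exists <<M>>%MS; split.
- have := genmx_subspaces M.
  by rewrite (rank_adds_row hx) mxrankMfree ?infinity_free // rA.
- rewrite genmxE; apply: contra (point_infinityN x); apply: submx_trans.
  exact: addsmxSr.
apply/setP => v; rewrite mem_flat inE genmxE; apply/idP/idP.
  case/sub_addsmxP => -[u1 u2] /=; rewrite mulmxA mul_infinity mul_mx_row mulmx1.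
  rewrite add_row_mx add0r => /eq_row_mx[<- ->]; rewrite mul1mx addrK.
  exact: submxMl.
case/submxP => u hu.
have -> : (row_mx 1%:M v = u *m (A *m infinity) + row_mx 1%:M x)%R.
  by rewrite mulmxA -hu mul_infinity add_row_mx add0r subrK.
by rewrite addmx_sub ?addsmxSr // (submx_trans (submxMl _ _)) // addsmxSl.
Qed.

Definition lift_family k (Fm : {set {set 'rV[F]_n}}) : {set 'M[F]_(1 + n)} :=
  [set M in subspaces F (1 + n) k.+1 | ~~ (M <= infinity)%MS
                                       & affine_part M \in Fm].

Lemma card_lift_family k (Fm : {set {set 'rV[F]_n}}) :
  Fm \subset flats F n k ->
  #|lift_family k Fm| = #|Fm|.
Proof.
move=> /subsetP hF; have inj : {in lift_family k Fm &, injective affine_part}.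
  move=> M1 M2; rewrite !inE => /andP[/andP[/eqP g1 _] /andP[h1 _]].
  move=> /andP[/andP[/eqP g2 _] /andP[h2 _]] e.
  rewrite -g1 -g2; apply/genmxP.
  by rewrite -!affine_part_sub // e !subxx.
rewrite -(card_in_imset inj); apply: eq_card => S.
apply/imsetP/idP => [[M + ->]|hS]; first by rewrite !inE => /and3P[].
have [M [h1 h2 h3]] := flats_affine_part (hF S hS).
by exists M; rewrite ?[_ \in lift_family _ _]inE ?h1 ?h2 h3.
Qed.

End Homogenization.

(** * From pairs to d families *)

Lemma prod_leq_eq (I : finType) (f g : I -> nat) :
  (forall i, f i <= g i) -> (forall i, 0 < f i) ->
  \prod_i g i <= \prod_i f i -> forall i, f i = g i.
Proof.
move=> le_fg f0 le_gf i; apply/eqP; rewrite eqn_leq le_fg /=.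
move: le_gf; rewrite (bigD1 i) //= [leqRHS](bigD1 i) //=.
have le_p : \prod_(j | j != i) f j <= \prod_(j | j != i) g j.
  by apply: leq_prod => j _.
have : 0 < \prod_(j | j != i) f j by apply: prodn_gt0.
nia.
Qed.

Lemma neq_ordS d (i : 'I_d) : 1 < d -> ordS i != i.
Proof.
move=> d1; rewrite -val_eqE /=; have := ltn_ord i.
case: (ltngtP i.+1 d) => // [lt_i|eq_i] _; first by rewrite modn_small // gtn_eqF.
by rewrite eq_i modnn; case: (i : nat) eq_i => //; lia.
Qed.

Theorem theorem3p3 (F : finFieldType) (d n t : nat) (k : 'I_d -> nat)
  (hd : 1 < d) (ht : 0 < t)
  (hk : forall i j : 'I_d, i <= j -> k j <= k i)
  (hkt : forall i : 'I_d, t <= k i)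
  (hn : k (Ordinal (ltnW hd)) + k (Ordinal hd) + 3 <= n)
  (Fam : 'I_d -> {set {set 'rV[F]_n}})
  (hFam : cross_intersecting t k Fam)
  (hmax : forall G : 'I_d -> {set {set 'rV[F]_n}},
     cross_intersecting t k G ->
     \prod_(i < d) #|G i| <= \prod_(i < d) #|Fam i|) :
  exists2 T : {set 'rV[F]_n}, T \in flats F n t &
    forall i : 'I_d, Fam i = [set S in flats F n (k i) | T \subset S].
Proof.
case: hFam => subFam intFam.
have k_pair i j : i != j -> k i + k j + 3 <= n.
  wlog lt_ij : i j / i < j => [IH|] ij.
    case: (ltngtP i j) ij => [lt_ij|lt_ij|/val_inj->]; rewrite ?eqxx // => ij.
      exact: IH.
    by rewrite [k i + _]addnC; apply: IH; rewrite // eq_sym.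
  have : k i <= k (Ordinal (ltnW hd)) by apply: hk.
  have : k j <= k (Ordinal hd) by apply: hk => /=; lia.
  lia.
have k_lt i : k i + 3 <= n.
  by have := k_pair _ _ (neq_ordS i hd); lia.
pose g i := star_card F (1 + n) (k i).+1 t.+1.
have g0 i : 0 < g i by apply: star_card_gt0; have := k_lt i; have := hkt i; lia.
pose L i := lift_family (k i) (Fam i).
have cardL i : #|L i| = #|Fam i| by apply: card_lift_family.
(* Maximality is compared with the families of all flats through one fixed t-flat, the affine part
   of [T0]; putting the point (1, 0) into [T0] keeps it off infinity. *)
have lower : \prod_i g i <= \prod_i #|L i|.
  have [|||T0 [sT0 _ rT0]] :=
    @exists_rank_between F (1 + n) _ _ (row_mx 1%:M 0 : 'rV_(1 + n))%R
      (1%:M : 'M_(1 + n))%R t.+1.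
  - exact: submx1.
  - by rewrite (leq_trans (rank_leq_row _)).
  - by rewrite mxrank1; have := k_lt (Ordinal hd); have := hkt (Ordinal hd); lia.
  have T0i : ~~ (T0 <= infinity F n)%MS.
    by apply: contra (point_infinityN (0%R : 'rV[F]_n)); apply: submx_trans.
  pose G i := [set S in flats F n (k i) | affine_part T0 \subset S].
  have subG i : G i \subset flats F n (k i) by apply/subsetP => S; rewrite inE => /andP[].
  have cardG i : #|G i| = g i.
    rewrite -(card_lift_family (subG i)) /g -rT0 -card_star; apply: eq_card => M.
    rewrite ![in LHS]inE [in RHS]inE andbA.
    have [hM|] := boolP (M \in _); last by rewrite inE => /negPf ->.
    have := hM; rewrite inE => -> /=.
    rewrite affine_part_sub //; apply/idP/idP => [/and3P[]//|sM].
    have hMi : ~~ (M <= infinity F n)%MS by apply: contra T0i; apply: submx_trans.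
    by rewrite sM hMi affine_part_flats // (rank_subspaces hM).
  under eq_bigr do rewrite -cardG.
  under [leqRHS]eq_bigr do rewrite cardL.
  apply: hmax; split=> // S hS.
  have /fin_all_exists[M hM] : forall i, exists M, [/\ M \in subspaces F (1 + n) (k i).+1,
      ~~ (M <= infinity F n)%MS & affine_part M = S i].
    by move=> i; apply: flats_affine_part; apply: (subsetP (subG i)).
  pose C := (\bigcap_i M i)%MS.
  have -> : \bigcap_i S i = affine_part C.
    apply/setP => v; rewrite inE; apply/bigcapP/sub_bigcapmxP => h i _.
      by have [_ _ e] := hM i; have := h i isT; rewrite -e inE.
    by have [_ _ <-] := hM i; rewrite inE; apply: h.
  have sT0C : (T0 <= C)%MS.
    apply/sub_bigcapmxP => i _; have [_ _ e] := hM i.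
    by rewrite -affine_part_sub // e; have := hS i; rewrite inE => /andP[].
  have rC : t < \rank C by rewrite -rT0 mxrankS.
  exists (\rank C).-1; first by rewrite -ltnS (ltn_predK rC).
  apply: affine_part_flats; last by rewrite (ltn_predK rC).
  by apply: contra T0i; apply: submx_trans.
have L0 i : 0 < #|L i|.
  have : 0 < \prod_i #|L i| by apply: leq_trans lower; apply: prodn_gt0.
  by rewrite (bigD1 i) //= muln_gt0 => /andP[].
have pair i j : i != j -> g i * g j <= #|L i| * #|L j| ->
    exists T, [/\ \rank T = t.+1, L i \subset star (k i).+1 T
                & L j \subset star (k j).+1 T].
  move=> ij; have := hkt i; have := hkt j; have := k_pair i j ij => kij ti tj.
  have subL l : L l \subset subspaces F (1 + n) (k l).+1.
    by apply/subsetP => M; rewrite inE => /andP[].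
  apply: cross_pair => //; rewrite -?card_gt0 //; first lia.
  move=> A B hA hB.
  (* A and B are completed to a d-tuple by arbitrary members of the other families. The common flat
     has dimension at least t, so its lift, of rank at least t + 1, lies in both A and B. *)
  have : forall l, exists S, S \in Fam l.
    by move=> l; apply/set0Pn; rewrite -card_gt0 -cardL.
  case/fin_all_exists => S0 hS0.
  pose S l := if l == i then affine_part A else
              if l == j then affine_part B else S0 l.
  have hS l : S l \in Fam l.
    rewrite /S; case: eqP => [->|_]; first by move: hA; rewrite inE => /and3P[].
    by case: eqP => [->|_]; [move: hB; rewrite inE => /and3P[] | apply: hS0].
  have [m le_tm /flats_affine_part[M [hM Mi eM]]] := intFam S hS.
  apply: (@leq_trans (\rank M)); first by rewrite (rank_subspaces hM).
  have sub_l l : affine_part M \subset S l by rewrite eM; apply: bigcap_inf.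
  apply: mxrankS; rewrite sub_capmx -!affine_part_sub //.
  have := sub_l i; have := sub_l j.
  by rewrite /S eq_sym (negPf ij) !eqxx => -> ->.
have le_star i T : \rank T = t.+1 -> L i \subset star (k i).+1 T -> #|L i| <= g i.
  by move=> rT sL; rewrite /g -rT -card_star subset_leq_card.
(* If the product reaches that of two stars, [pair] puts both families inside stars, which bounds
   each factor. *)
have le_pair i : #|L (ordS i)| * #|L i| <= g (ordS i) * g i.
  case: (leqP (g (ordS i) * g i) (#|L (ordS i)| * #|L i|)) => [le_g|/ltnW //].
  have [T [rT hj hi]] := pair _ _ (neq_ordS i hd) le_g.
  by apply: leq_mul; apply: (le_star _ T).
have prod_shift (f : 'I_d -> nat) : \prod_i (f (ordS i) * f i) = (\prod_i f i) ^ 2.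
  have e : \prod_i f i = \prod_i f (ordS i) by exact: reindex_inj (@ordS_inj d).
  by rewrite big_split /= -e expnS expn1.
have eq_pair := prod_leq_eq le_pair.
(* Each family lies in two cyclic pairs, so the pair products multiply to the square of the whole
   product. Hence [lower] forces equality in every [le_pair], and [pair] applies. *)
have le_Lg i : #|L i| <= g i.
  have [|T [rT _ hi]] := pair _ _ (neq_ordS i hd).
  - rewrite eq_pair // => [j|]; first by rewrite muln_gt0 !L0.
    by rewrite !prod_shift leq_expn2r.
  - exact: le_star rT hi.
have eqL := prod_leq_eq le_Lg L0 lower.
have eq_star_L i T : \rank T = t.+1 -> L i \subset star (k i).+1 T ->
    L i = star (k i).+1 T.
  by move=> rT sL; apply/eqP; rewrite eqEcard sL card_star rT eqL leqnn.
pose i0 := Ordinal (ltnW hd).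
have [|T [rT _ hT0]] := pair _ _ (neq_ordS i0 hd); first by rewrite !eqL.
have starL i : L i = star (k i).+1 T.
  have [->|ni] := eqVneq i i0; first exact: eq_star_L.
  (* The pair (i, i0) may give another centre T', but [L i0] is the full star of both T and T', so
     they agree. *)
  have [|T' [rT' hi hT'0]] := pair _ _ ni; first by rewrite !eqL.
  have eqT : (T :=: T')%MS.
    apply: (@star_inj _ _ (k i0).+1); rewrite ?rT ?rT' //.
    - exact: hkt.
    - by have := k_lt i0; lia.
    - by rewrite -(eq_star_L _ _ rT hT0).
  by rewrite (eq_star_L _ _ rT' hi) (eq_star _ eqT).
(* Otherwise a W between T and the hyperplane at infinity would be in the star of T, that is in
   [L i0], whose members are all off infinity. *)
have Ti : ~~ (T <= infinity F n)%MS.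
  apply/negP => Ti; have rI : \rank (infinity F n) = n.
    by apply/eqP/infinity_free.
  have [||W [sTW sWI rW]] := exists_rank_between (k := (k i0).+1) Ti.
  - by rewrite rT; apply: hkt.
  - by rewrite rI; have := k_lt i0; lia.
  have : <<W>>%MS \in L i0.
    by rewrite starL inE -rW genmx_subspaces genmxE.
  by rewrite inE genmxE sWI andbF.
exists (affine_part T); first exact: affine_part_flats.
move=> i; apply/setP => S; rewrite inE; apply/idP/andP => [hS|[hS sTS]].
  have hSf := subsetP (subFam i) S hS; split=> //.
  have [M [hM Mi eM]] := flats_affine_part hSf.
  have : M \in L i by rewrite inE hM Mi eM.
  by rewrite starL inE -eM affine_part_sub // => /andP[].
have [M [hM Mi eM]] := flats_affine_part hS.
have : M \in L i by rewrite starL inE hM -affine_part_sub // eM.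
by rewrite inE eM => /and3P[].
Qed.
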